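(* Let $(X,r)$ be a solution (a bijective non-degenerate set-theoretic solution to the Yang--Baxter equation, on a nonempty set $X$ of arbitrary cardinality), and let $\mathcal{G}(X,r)$ be its permutation skew brace. Then $$\mathrm{mpl}'(X,r)=\mathrm{mpl}(\mathcal{G}(X,r)).$$
   Context: A skew brace is a triple $(A,+,\circ)$ with $(A,+)$, $(A,\circ)$ groups (not necessarily abelian) and $a\circ(b+c)=a\circ b-a+a\circ c$; both groups have the same identity $0$. Put $\lambda_a(b)=-a+a\circ b$. An ideal is a subgroup $I$ of $(A,+)$ that is normal in $(A,+)$ and in $(A,\circ)$ and satisfies $\lambda_a(I)\subseteq I$ for all $a\in A$; then the quotient skew brace $A/I$ is defined. $\mathrm{Soc}(A)=\{x\in A\mid x\circ a=x+a=a+x\ \forall a\in A\}$ is an ideal; $\mathrm{Ret}(A)=A/\mathrm{Soc}(A)$, $\mathrm{Ret}^0(A)=A$, $\mathrm{Ret}^{n+1}(A)=\mathrm{Ret}(\mathrm{Ret}^n(A))$. $\mathrm{mpl}(A)$ is the smallest $n\ge 0$ with $\mathrm{Ret}^n(A)=0$ ($\infty$ if there is none). A solution is a pair $(X,r)$ with $X$ a nonempty set and $r:X^2\to X^2$ a bijection, $r(x,y)=(\sigma_x(y),\tau_y(x))$, such that $(r\times \mathrm{id})(\mathrm{id}\times r)(r\times \mathrm{id})=(\mathrm{id}\times r)(r\times \mathrm{id})(\mathrm{id}\times r)$ and all $\sigma_x,\tau_x:X\to X$ are bijective. It is trivial if $r(x,y)=(y,x)$ for all $x,y$. The retraction $\mathrm{Ret}(X,r)$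 is the induced solution on $X/{\sim}$, where $x\sim y$ iff $\sigma_x=\sigma_y$ and $\tau_x=\tau_y$; $\mathrm{Ret}^0(X,r)=(X,r)$, $\mathrm{Ret}^{n+1}(X,r)=\mathrm{Ret}(\mathrm{Ret}^n(X,r))$. $\mathrm{mpl}'(X,r)$ is the smallest $n\geq 0$ such that $\mathrm{Ret}^n(X,r)$ is a trivial solution (possibly of size $>1$), and $\infty$ if there is none. The structure group is $G(X,r)=\langle X\mid x\circ y=\sigma_x(y)\circ\tau_y(x)\rangle$, with canonical map $\iota:X\to G(X,r)$. It is known that there is a unique skew brace structure $(G(X,r),+,\circ)$ whose multiplicative group is $G(X,r)$, whose additive group is generated by $\iota(X)$ with defining relations $x+y=y+\sigma_y\tau_{\sigma_x^{-1}(y)}(x)$ ($x,y\in X$), and with $\lambda_{\iota(x)}(\iota(y))=\iota(\sigma_x(y))$. The permutation group is $\mathcal{G}(X,r)=\langle(\sigma_x,\tau_x^{-1})\mid x\in X\rangle\le \mathrm{Perm}(X)\times\mathrm{Perm}(X)$. The kernel of the surjective group homomorphism $\pi:(G(X,r),\circ)\to\mathcal{G}(X,r)$, $\iota(x)\mapsto(\sigma_x,\tau_x^{-1})$, is an ideal of the skew brace $G(X,r)$; the permutation skew brace is $\mathcal{G}(X,r)$ with the quotient skew brace structure making $\pi$ a skew brace homomorphism. *)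

(* Defs.v *)
From HB Require Import structures.
From mathcomp Require Import all_boot.
From mathcomp Require Import boolp.

Set Implicit Arguments.
Unset Strict Implicit.
Unset Printing Implicit Defensive.

Local Open Scope group_scope.
Local Open Scope quotient_scope.

Record subgroup (G : groupType) (N : G -> Prop) : Prop := Subgroup {
  subgroup1 : N 1;
  subgroupM : forall x y, N x -> N y -> N (x * y);
  subgroupV : forall x, N x -> N x^-1 }.

Record normal_subgroup (G : groupType) (N : G -> Prop) : Prop := NormalSubgroup {
  normal_sub :> subgroup N;
  normalJ : forall a x, N x -> N (a * x * a^-1) }.

Definition generated (G : groupType) (P : G -> Prop) (g : G) : Prop :=
  forall N : G -> Prop, subgroup N -> (forall x, P x -> N x) -> N g.

Lemma subgroup_generated (G : groupType) (P : G -> Prop) :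
  subgroup (generated P).
Proof.
split=> [N sN _|x y gx gy N sN PN|x gx N sN PN]; first exact: subgroup1.
  by apply: subgroupM => //; [exact: gx|exact: gy].
by apply: subgroupV => //; exact: gx.
Qed.

Record generated_subgroup (G : groupType) (P : G -> Prop) : Type := GeneratedSub {
  generated_val :> G;
  generated_valP : `[< generated P generated_val >] }.

Section GeneratedSubgroup.
Variables (G : groupType) (P : G -> Prop).

Lemma generated_group_closed :
  group_closed (fun g : G => `[< generated P g >]).
Proof.
have sP := subgroup_generated P.
split=> [|x y]; rewrite /in_mem /=; first by apply/asboolP; exact (subgroup1 sP).
move=> /asboolP gx /asboolP gy; apply/asboolP.
exact (subgroupM sP gx (subgroupV sP gy)).
Qed.

HB.instance Definition _ := [isSub for @generated_val G P].
HB.instance Definition _ := [Choice of generated_subgroup P by <:].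
HB.instance Definition _ := SubChoice_isSubGroup.Build G
  (fun g : G => `[< generated P g >]) (generated_subgroup P) generated_group_closed.
End GeneratedSubgroup.

Section QuotientGroup.
Variables (G : groupType) (N : G -> Prop) (nN : normal_subgroup N).

Definition coset_rel : rel G := fun x y => `[< N (x^-1 * y) >].

Lemma coset_refl : reflexive coset_rel.
Proof. by move=> x; apply/asboolP; rewrite mulVg; exact (subgroup1 nN). Qed.

Lemma coset_sym : symmetric coset_rel.
Proof.
suff H x y : coset_rel x y -> coset_rel y x by move=> x y; apply/idP/idP; exact: H.
move=> /asboolP Nxy; apply/asboolP.
by have := subgroupV nN Nxy; rewrite invgM invgK.
Qed.

Lemma coset_trans : transitive coset_rel.
Proof.
move=> y x z /asboolP xy /asboolP yz; apply/asboolP.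
by have := subgroupM nN xy yz; rewrite mulgA mulgK.
Qed.

Canonical coset_equiv := EquivRel coset_rel coset_refl coset_sym coset_trans.

Definition quotient_group : Type := {eq_quot coset_equiv}.
HB.instance Definition _ := Choice.on quotient_group.

Definition coset (x : G) : quotient_group := \pi_{eq_quot coset_equiv} x.
Definition coset_repr (a : quotient_group) : G :=
  repr (a : {eq_quot coset_equiv}).

Lemma coset_reprK : cancel coset_repr coset.
Proof. exact: reprK. Qed.

Lemma coset_eqP (x y : G) :
  coset x = coset y <-> N (x^-1 * y).
Proof.
have -> : (coset x = coset y) = (coset_rel x y : Prop).
  by apply/propext; split=> [/eqmodP|H]; [|apply/eqmodP].
by split=> /asboolP.
Qed.

Definition quotient_mul (a b : quotient_group) : quotient_group :=
  coset (coset_repr a * coset_repr b).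
Definition quotient_one : quotient_group := coset 1.
Definition quotient_inv (a : quotient_group) : quotient_group := coset (coset_repr a)^-1.

Lemma cosetM (x y : G) :
  coset (x * y) = quotient_mul (coset x) (coset y).
Proof.
apply/coset_eqP; set x' := coset_repr _; set y' := coset_repr _.
have /coset_eqP Nx : coset x = coset x' by rewrite coset_reprK.
have /coset_eqP Ny : coset y = coset y' by rewrite coset_reprK.
have := subgroupM nN (normalJ nN (y^-1) Nx) Ny.
by rewrite invgK invgM !mulgA mulgK.
Qed.

Lemma cosetV (x : G) : coset x^-1 = quotient_inv (coset x).
Proof.
apply/coset_eqP; set x' := coset_repr _; rewrite invgK.
have /coset_eqP Nx : coset x' = coset x by rewrite coset_reprK.
by have := normalJ nN x' Nx; rewrite !mulgA mulgV mul1g.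
Qed.

Lemma quotient_mulA : associative quotient_mul.
Proof.
move=> a b c; rewrite -[a]coset_reprK -[b]coset_reprK -[c]coset_reprK.
by rewrite -!cosetM mulgA.
Qed.

Lemma quotient_mul1 : left_id quotient_one quotient_mul.
Proof. by move=> a; rewrite -[a]coset_reprK -cosetM mul1g. Qed.

Lemma quotient_mulr1 : right_id quotient_one quotient_mul.
Proof. by move=> a; rewrite -[a]coset_reprK -cosetM mulg1. Qed.

Lemma quotient_mulV : left_inverse quotient_one quotient_inv quotient_mul.
Proof. by move=> a; rewrite -[a]coset_reprK -cosetV -cosetM mulVg. Qed.

Lemma quotient_mulVr : right_inverse quotient_one quotient_inv quotient_mul.
Proof. by move=> a; rewrite -[a]coset_reprK -cosetV -cosetM mulgV. Qed.

HB.instance Definition _ := isGroup.Build quotient_group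
  quotient_mulA quotient_mul1 quotient_mulr1 quotient_mulV quotient_mulVr.

End QuotientGroup.

(** [presented R] is the group < X | u = v for all (u, v) with R u v >; the letter
    [(x, true)] of a word stands for the inverse of the generator [x]. *)

Definition word (X : Type) : Type := seq (X * bool).

Inductive presented_eq (X : Type) (R : word X -> word X -> Prop) :
    word X -> word X -> Prop :=
  | PresentedRefl u : presented_eq R u u
  | PresentedSym u v : presented_eq R u v -> presented_eq R v u
  | PresentedTrans v u w :
      presented_eq R u v -> presented_eq R v w -> presented_eq R u w
  | PresentedCat u u' v v' :
      presented_eq R u u' -> presented_eq R v v' ->
      presented_eq R (u ++ v) (u' ++ v')
  | PresentedCancel x b : presented_eq R [:: (x, b); (x, ~~ b)] [::]
  | PresentedRel u v : R u v -> presented_eq R u v.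

Section Presented.
Variables (X : Type) (R : word X -> word X -> Prop).

Definition presented_rel : rel {classic word X} :=
  fun u v => `[< presented_eq R u v >].

Lemma presented_refl : reflexive presented_rel.
Proof. by move=> u; apply/asboolP/PresentedRefl. Qed.

Lemma presented_sym : symmetric presented_rel.
Proof. by move=> u v; apply/asboolP/asboolP => /PresentedSym. Qed.

Lemma presented_trans : transitive presented_rel.
Proof.
by move=> v u w /asboolP uv /asboolP vw; apply/asboolP/(PresentedTrans uv vw).
Qed.

Canonical presented_equiv :=
  EquivRel presented_rel presented_refl presented_sym presented_trans.

Definition presented : Type := {eq_quot presented_equiv}.
HB.instance Definition _ := Choice.on presented.

Definition word_class (w : word X) : presented := \pi_{eq_quot presented_equiv} w.
Definition word_repr (g : presented) : word X :=
  repr (g : {eq_quot presented_equiv}).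

Lemma word_reprK : cancel word_repr word_class.
Proof. exact: reprK. Qed.

Lemma word_classP (u v : word X) :
  word_class u = word_class v <-> presented_eq R u v.
Proof.
have -> : (word_class u = word_class v) = (presented_rel u v : Prop).
  by apply/propext; split=> [/eqmodP|H]; [|apply/eqmodP].
by split=> /asboolP.
Qed.

Definition word_inv (w : word X) : word X :=
  rev [seq (l.1, ~~ l.2) | l <- w].

Definition presented_mul (g h : presented) : presented :=
  word_class (word_repr g ++ word_repr h).
Definition presented_one : presented := word_class [::].
Definition presented_inv (g : presented) : presented :=
  word_class (word_inv (word_repr g)).

Lemma word_class_cat u v :
  word_class (u ++ v) = presented_mul (word_class u) (word_class v).
Proof.
by apply/word_classP/PresentedCat; apply/word_classP; rewrite word_reprK.
Qed.

Lemma word_invK : involutive word_inv.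
Proof.
move=> w; rewrite /word_inv map_rev revK -map_comp.
by rewrite -[RHS]map_id; apply: eq_map => -[x b] /=; rewrite negbK.
Qed.

Lemma word_catV (w : word X) : presented_eq R (w ++ word_inv w) [::].
Proof.
elim: w => [|[x b] w IH]; first exact: PresentedRefl.
rewrite /word_inv /= rev_cons -cats1 -cat1s.
apply: (PresentedTrans (v := [:: (x, b)] ++ [::] ++ [:: (x, ~~ b)])); last first.
  exact: PresentedCancel.
apply: PresentedCat; first exact: PresentedRefl.
by rewrite catA; apply: PresentedCat => //; exact: PresentedRefl.
Qed.

Lemma presented_mulA : associative presented_mul.
Proof.
move=> a b c; rewrite -[a]word_reprK -[b]word_reprK -[c]word_reprK.
by rewrite -!word_class_cat catA.
Qed.

Lemma presented_mul1 : left_id presented_one presented_mul.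
Proof. by move=> a; rewrite -[a]word_reprK -word_class_cat. Qed.

Lemma presented_mulr1 : right_id presented_one presented_mul.
Proof. by move=> a; rewrite -[a]word_reprK -word_class_cat cats0. Qed.

Lemma presented_mulVr : right_inverse presented_one presented_inv presented_mul.
Proof.
move=> a; rewrite -{1}[a]word_reprK -word_class_cat.
by apply/word_classP; exact: word_catV.
Qed.

Lemma presented_mulV : left_inverse presented_one presented_inv presented_mul.
Proof.
move=> a; rewrite -{2}[a]word_reprK -word_class_cat.
by apply/word_classP; rewrite -{2}[word_repr a]word_invK; exact: word_catV.
Qed.

HB.instance Definition _ := isGroup.Build presented
  presented_mulA presented_mul1 presented_mulr1 presented_mulV presented_mulVr.

Definition presented_gen (x : X) : presented := word_class [:: (x, false)].

Lemma presented_ind (P : presented -> Prop) :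
  subgroup P -> (forall x, P (presented_gen x)) -> forall g, P g.
Proof.
move=> sP Pgen g; rewrite -[g]word_reprK.
elim: (word_repr g) => [|[x b] w IH]; first exact: (subgroup1 sP).
rewrite -cat1s word_class_cat; apply: (subgroupM sP) => //.
case: b; last exact: Pgen.
have <- : (presented_gen x)^-1 = word_class [:: (x, true)].
  apply: mulg1_eq; rewrite -[LHS]word_class_cat.
  exact/word_classP/PresentedCancel.
exact: (subgroupV sP).
Qed.

Section Lift.
Variables (H : groupType) (f : X -> H).

Fixpoint word_eval (w : word X) : H :=
  if w is (x, b) :: w' then (if b then (f x)^-1 else f x) * word_eval w' else 1.

Definition respects := forall u v, R u v -> word_eval u = word_eval v.

Definition presented_lift (g : presented) : H := word_eval (word_repr g).

Lemma word_eval_cat u v : word_eval (u ++ v) = word_eval u * word_eval v.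
Proof. by elim: u => [|[x b] u IH] /=; rewrite ?mul1g // IH mulgA. Qed.

Hypothesis Rf : respects.

Lemma word_eval_eq u v : presented_eq R u v -> word_eval u = word_eval v.
Proof.
elim=> {u v} // [v u w _ -> _ ->|u u' v v' _ IHu _ IHv|x b] //.
  by rewrite !word_eval_cat IHu IHv.
by case: b => /=; rewrite mulg1 ?mulVg ?mulgV.
Qed.

Lemma presented_lift_class w : presented_lift (word_class w) = word_eval w.
Proof. by apply: word_eval_eq; apply/word_classP; rewrite word_reprK. Qed.

Lemma presented_lift_gen x : presented_lift (presented_gen x) = f x.
Proof. by rewrite presented_lift_class /= mulg1. Qed.

Lemma presented_liftM : {morph presented_lift : g h / g * h}.
Proof.
move=> g h; rewrite -[g]word_reprK -[h]word_reprK -[X in presented_lift X]word_class_cat.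
by rewrite !presented_lift_class word_eval_cat.
Qed.

Lemma presented_lift1 : presented_lift 1 = 1.
Proof. exact: presented_lift_class. Qed.

Lemma presented_liftV g : presented_lift g^-1 = (presented_lift g)^-1.
Proof.
by apply/esym/mulg1_eq; rewrite -presented_liftM mulgV presented_lift1.
Qed.

End Lift.

End Presented.

(** Composition convention: [(f * g) x = f (g x)]. *)

Record Perm (X : Type) := MkPerm {
  perm_fun :> {classic X -> X};
  _ : `[< bijective perm_fun >] }.
HB.instance Definition _ (X : Type) := [isSub for @perm_fun X].
HB.instance Definition _ (X : Type) := [Choice of Perm X by <:].

Section Perm.
Variable X : Type.
Implicit Types f g h : Perm X.

Definition papp f : X -> X := perm_fun f.

Definition mk_perm (f : X -> X) (bij_f : bijective f) : Perm X :=
  MkPerm (introT (asboolP _) bij_f).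

Lemma mk_permE (f : X -> X) (bij_f : bijective f) x : papp (mk_perm bij_f) x = f x.
Proof. by []. Qed.

Lemma papp_bij f : bijective (papp f).
Proof. by apply/asboolP; case: f. Qed.

Lemma papp_inj f : injective (papp f).
Proof. exact/bij_inj/papp_bij. Qed.

Lemma perm_ext f g : papp f =1 papp g -> f = g.
Proof. by move=> fg; apply/val_inj/funext. Qed.

Definition papp_inv f : X -> X :=
  projT1 (cid (let: Bijective g fK gK := papp_bij f in
    ex_intro (fun g : X -> X => cancel (papp f) g /\ cancel g (papp f)) g (conj fK gK))).

Lemma pappK f : cancel (papp f) (papp_inv f).
Proof. by rewrite /papp_inv; case: cid => g []. Qed.

Lemma pappKV f : cancel (papp_inv f) (papp f).
Proof. by rewrite /papp_inv; case: cid => g []. Qed.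

Lemma papp_inv_bij f : bijective (papp_inv f).
Proof. exact: (Bijective (pappKV f) (pappK f)). Qed.

Definition Perm_mul f g : Perm X := mk_perm (bij_comp (papp_bij f) (papp_bij g)).
Definition Perm_one : Perm X := mk_perm (Bijective (frefl id) (frefl id)).
Definition Perm_inv f : Perm X := mk_perm (papp_inv_bij f).

Lemma Perm_mulA : associative Perm_mul.
Proof. by move=> f g h; apply: perm_ext. Qed.

Lemma Perm_mul1 : left_id Perm_one Perm_mul.
Proof. by move=> f; apply: perm_ext. Qed.

Lemma Perm_mulr1 : right_id Perm_one Perm_mul.
Proof. by move=> f; apply: perm_ext. Qed.

Lemma Perm_mulV : left_inverse Perm_one Perm_inv Perm_mul.
Proof. by move=> f; apply: perm_ext => x; exact: pappK. Qed.

Lemma Perm_mulVr : right_inverse Perm_one Perm_inv Perm_mul.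
Proof. by move=> f; apply: perm_ext => x; exact: pappKV. Qed.

HB.instance Definition _ := isGroup.Build (Perm X)
  Perm_mulA Perm_mul1 Perm_mulr1 Perm_mulV Perm_mulVr.

Lemma pappM f g x : papp (f * g) x = papp f (papp g x).
Proof. by []. Qed.

Lemma papp1 x : papp (1 : Perm X) x = x.
Proof. by []. Qed.

Lemma pappVK f x : papp f^-1 (papp f x) = x.
Proof. exact: pappK. Qed.

Lemma pappKVg f x : papp f (papp f^-1 x) = x.
Proof. exact: pappKV. Qed.

End Perm.

(** The multiplication of the underlying [groupType] is the circle operation;
    the common identity of the two groups is [1]. *)

HB.mixin Record Group_isSkewBrace A of Group A := {
  badd : A -> A -> A;
  bopp : A -> A;
  baddA : associative badd;
  badd1 : left_id 1 badd;
  baddN : left_inverse 1 bopp badd;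
  bmulD : forall a b c : A,
    a * badd b c = badd (badd (a * b) (bopp a)) (a * c) }.

#[short(type="skewBraceType")]
HB.structure Definition SkewBrace := {A of Group_isSkewBrace A & Group A}.

Declare Scope brace_scope.
Delimit Scope brace_scope with B.
Notation "a + b" := (badd a b) : brace_scope.
Notation "- a" := (bopp a) : brace_scope.
Notation "a - b" := (badd a (bopp b)) : brace_scope.
Local Open Scope brace_scope.

Section AdditiveGroup.
Variable A : skewBraceType.
Implicit Types a b c : A.

Lemma baddNr a : a - a = 1.
Proof.
rewrite -[LHS]badd1 -[X in X + _](baddN (- a)) -baddA [X in _ + X]baddA.
by rewrite baddN badd1 baddN.
Qed.

Lemma baddr1 a : a + 1 = a.
Proof. by rewrite -(baddN a) baddA baddNr badd1. Qed.

End AdditiveGroup.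

Definition additive (A : skewBraceType) : Type := A.
HB.instance Definition _ (A : skewBraceType) := Choice.on (additive A).
HB.instance Definition _ (A : skewBraceType) := isGroup.Build (additive A)
  (@baddA A) (@badd1 A) (@baddr1 A) (@baddN A) (@baddNr A).

Section SkewBraceTheory.
Variable A : skewBraceType.
Implicit Types a b c x : A.

Lemma baddKg a b : - a + (a + b) = b.
Proof. exact: (@mulKg (additive A)). Qed.
Lemma baddVKg a b : a + (- a + b) = b.
Proof. exact: (@mulVKg (additive A)). Qed.
Lemma baddgK a b : a + b - b = a.
Proof. exact: (@mulgK (additive A)). Qed.
Lemma baddgVK a b : a - b + b = a.
Proof. exact: (@mulgVK (additive A)). Qed.
Lemma baddI a b c : a + b = a + c -> b = c.
Proof. exact: (@mulgI (additive A)). Qed.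
Lemma boppK a : - (- a) = a.
Proof. exact: (@invgK (additive A)). Qed.
Lemma boppD a b : - (a + b) = - b - a.
Proof. exact: (@invgM (additive A)). Qed.
Lemma badd_eq1 a b : a + b = 1 -> - a = b.
Proof. exact: (@mulg1_eq (additive A)). Qed.

Definition blambda a b : A := - a + a * b.

Lemma bmulE a b : a * b = a + blambda a b.
Proof. by rewrite baddVKg. Qed.

Lemma blambdaD a b c : blambda a (b + c) = blambda a b + blambda a c.
Proof. by rewrite /blambda bmulD !baddA. Qed.

Lemma blambda1 a : blambda a 1 = 1.
Proof. by rewrite /blambda mulg1 baddN. Qed.

Lemma blambdaN a b : blambda a (- b) = - blambda a b.
Proof. by apply/esym/badd_eq1; rewrite -blambdaD baddNr blambda1. Qed.

Lemma blambdaM a b c : blambda (a * b) c = blambda a (blambda b c).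
Proof.
rewrite [blambda b c]/blambda blambdaD blambdaN.
apply: (@baddI (a * b)); rewrite -bmulE -mulgA [in RHS](bmulE a b).
by rewrite -baddA baddVKg -bmulE.
Qed.

Lemma blambda1l b : blambda 1 b = b.
Proof. by rewrite /blambda mul1g (badd_eq1 (badd1 1)) badd1. Qed.

Lemma blambdaK a b : blambda a^-1 (blambda a b) = b.
Proof. by rewrite -blambdaM mulVg blambda1l. Qed.
Lemma blambdaVK a b : blambda a (blambda a^-1 b) = b.
Proof. by rewrite -blambdaM mulgV blambda1l. Qed.

Lemma baddE a b : a + b = a * blambda a^-1 b.
Proof. by rewrite bmulE blambdaVK. Qed.

Lemma bmulV a : a^-1 = - blambda a^-1 a.
Proof. by rewrite /blambda mulVg baddr1 boppK. Qed.

Lemma bopp_mulV a : - a = blambda a a^-1.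
Proof. by rewrite /blambda mulgV baddr1. Qed.

Record ideal (I : A -> Prop) : Prop := Ideal {
  ideal_add : normal_subgroup (G := additive A) I;
  ideal_mul : normal_subgroup (G := A) I;
  ideal_lambda : forall a x, I x -> I (blambda a x) }.

End SkewBraceTheory.

(** Given a surjective group morphism [p] from the multiplicative group of a skew
    brace, whose kernel is an ideal, [push_add] is the addition on the target for
    which [p] is a morphism of skew braces. *)
Section Push.
Variables (A : skewBraceType) (B : groupType) (p : A -> B) (s : B -> A).
Hypothesis pM : {morph p : a b / a * b}.
Hypothesis sK : cancel s p.
Hypothesis ker_ideal : ideal (fun a => p a = 1).

Definition push_add (a b : B) : B := p (s a + s b).
Definition push_opp (a : B) : B := p (- s a).

Lemma push_p1 : p 1 = 1.
Proof. by apply: (@mulgI _ (p 1)); rewrite -pM !mulg1. Qed.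

Lemma push_pV a : p a^-1 = (p a)^-1.
Proof. by apply/esym/mulg1_eq; rewrite -pM mulgV push_p1. Qed.

Lemma push_eqP a b : p a = p b <-> p (- a + b) = 1.
Proof.
have E : blambda a (a^-1 * b) = - a + b.
  by rewrite /blambda mulVKg.
split=> [pab|pab].
  rewrite -E; apply: (ideal_lambda ker_ideal).
  by rewrite pM push_pV pab mulVg.
have := ideal_lambda ker_ideal a^-1 pab.
rewrite -E blambdaK pM push_pV => /mulg1_eq.
by rewrite invgK.
Qed.

Lemma push_addP a b : p (a + b) = push_add (p a) (p b).
Proof.
have nK := ideal_add ker_ideal.
rewrite /push_add; set a' := s (p a); set b' := s (p b).
have /push_eqP Ha : p a = p a' by rewrite sK.
have /push_eqP Hb : p b = p b' by rewrite sK.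
apply/push_eqP; rewrite boppD.
have := subgroupM (normal_sub nK) (normalJ nK (- b) Ha) Hb.
rewrite /mul /= /inv /= boppK.
suff -> : - b + (- a + a') + b + (- b + b') = - b - a + (a' + b') by [].
by rewrite -!baddA baddVKg.
Qed.

Lemma push_oppP a : p (- a) = push_opp (p a).
Proof.
have nK := ideal_add ker_ideal.
apply/push_eqP; set a' := s (p a); rewrite boppK.
have /push_eqP Ha : p a' = p a by rewrite sK.
have := normalJ nK a' Ha; rewrite /mul /= /inv /=.
by rewrite baddVKg.
Qed.

Lemma push_addA : associative push_add.
Proof. by move=> a b c; rewrite -[a]sK -[b]sK -[c]sK -!push_addP baddA. Qed.
Lemma push_add1 : left_id 1 push_add.
Proof. by move=> a; rewrite -[a]sK -push_p1 -push_addP badd1. Qed.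
Lemma push_addN : left_inverse 1 push_opp push_add.
Proof. by move=> a; rewrite -[a]sK -push_oppP -push_addP baddN push_p1. Qed.
Lemma push_mulD (a b c : B) :
  a * push_add b c = push_add (push_add (a * b) (push_opp a)) (a * c).
Proof.
by rewrite -[a]sK -[b]sK -[c]sK -!(push_addP, push_oppP, pM) bmulD.
Qed.

End Push.

Section QuotientBrace.
Variables (A : skewBraceType) (I : A -> Prop) (idI : ideal I).

Definition quotient_brace : Type := quotient_group (ideal_mul idI).
Let pi : A -> quotient_brace := @coset A I (ideal_mul idI).
Let s : quotient_brace -> A := @coset_repr A I (ideal_mul idI).

HB.instance Definition _ := Group.on quotient_brace.

Lemma quotient_ker : ideal (fun a : A => pi a = 1).
Proof.
suff -> : (fun a : A => pi a = 1) = I by [].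
apply/funext => a; apply/propext; split=> [/esym/coset_eqP|Ia].
  by rewrite invg1 mul1g.
by apply/esym/coset_eqP; rewrite invg1 mul1g.
Qed.

Let piM : {morph pi : a b / a * b}.
Proof. exact: cosetM. Qed.
Let sK : cancel s pi.
Proof. exact: coset_reprK. Qed.

HB.instance Definition _ := Group_isSkewBrace.Build quotient_brace
  (push_addA piM sK quotient_ker) (push_add1 piM sK quotient_ker)
  (push_addN piM sK quotient_ker) (push_mulD piM sK quotient_ker).

Definition quotient_pi : A -> quotient_brace := pi.

Lemma quotient_piD : {morph quotient_pi : a b / a + b}.
Proof. exact: (push_addP piM sK quotient_ker). Qed.
Lemma quotient_piM : {morph quotient_pi : a b / a * b}.
Proof. exact: piM. Qed.
Lemma quotient_pi_eq1 a : quotient_pi a = 1 <-> I a.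
Proof.
split=> [/esym/coset_eqP|Ia]; first by rewrite invg1 mul1g.
by apply/esym/coset_eqP; rewrite invg1 mul1g.
Qed.
Lemma quotient_pi_surj (b : quotient_brace) : exists a, b = quotient_pi a.
Proof. by exists (s b); rewrite /quotient_pi sK. Qed.

End QuotientBrace.

Definition Soc (A : skewBraceType) (x : A) : Prop :=
  forall a : A, x * a = x + a /\ x + a = a + x.

Section Socle.
Variable A : skewBraceType.
Implicit Types a b x y : A.

Lemma SocP x :
  Soc x <-> (forall a, blambda x a = a) /\ (forall a, x + a = a + x).
Proof.
split=> [Sx|[lx cx] a]; last by rewrite bmulE lx.
split=> a; last by have [] := Sx a.
by have [H _] := Sx a; rewrite /blambda H baddKg.
Qed.

Lemma Soc_opp x : Soc x -> x^-1 = - x.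
Proof.
move=> Sx; apply: mulg1_eq; have [-> _] := Sx (- x).
exact: baddNr.
Qed.

Lemma Soc_subgroup : subgroup (G := A) (@Soc A).
Proof.
split=> [|x y Sx Sy|x Sx]; apply/SocP.
- by split=> a; rewrite ?blambda1l // badd1 baddr1.
- have [-> _] := Sx y; have /SocP[lx cx] := Sx; have /SocP[ly cy] := Sy.
  split=> a; last by rewrite -baddA cy baddA cx -baddA.
  by have [<- _] := Sx y; rewrite blambdaM ly lx.
have /SocP[lx cx] := Sx; split=> a.
  by rewrite -{1}[a]lx blambdaK.
rewrite (Soc_opp Sx); apply: (@baddI _ x).
by rewrite baddVKg baddA cx baddgK.
Qed.

Lemma Soc_conj a x : Soc x -> a * x * a^-1 = blambda a x.
Proof.
move=> /SocP[lx cx].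
have cent b : blambda a x + b = b + blambda a x.
  by rewrite -[b](blambdaVK a) -!blambdaD cx.
rewrite -mulgA bmulE [x * _]bmulE lx blambdaD cent -bopp_mulV.
by rewrite baddA baddNr badd1.
Qed.

Lemma Soc_lambda a x : Soc x -> Soc (blambda a x).
Proof.
move=> Sx; have /SocP[lx cx] := Sx; apply/SocP; split=> b; last first.
  by rewrite -[b](blambdaVK a) -!blambdaD cx.
by rewrite -(Soc_conj a Sx) !blambdaM lx blambdaVK.
Qed.

Lemma Soc_ideal : ideal (@Soc A).
Proof.
have sS := Soc_subgroup.
split; last exact: Soc_lambda.
  split; first split=> [|x y Sx Sy|x Sx]; first exact (subgroup1 sS).
  - have [E _] := Sx y; have := subgroupM sS Sx Sy.
    by rewrite E.
  - by have := subgroupV sS Sx; rewrite (Soc_opp Sx).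
  - move=> a x Sx; suff -> : a * x * a^-1 = x :> additive A by [].
    have /SocP[_ cx] := Sx.
    by rewrite /mul /= -cx baddgK.
split=> // a x Sx; rewrite (Soc_conj a Sx); exact: Soc_lambda.
Qed.

End Socle.

Definition Ret (A : skewBraceType) : skewBraceType := quotient_brace (@Soc_ideal A).

(** The least [n] such that [P n], or [None] (standing for infinity) *)
Definition least (P : nat -> Prop) : option nat :=
  if pselect (exists n, `[< P n >]) is left exP then Some (ex_minn exP) else None.

Lemma least_SomeP (P : nat -> Prop) (n : nat) :
  least P = Some n <-> P n /\ (forall m, P m -> (n <= m)%N).
Proof.
rewrite /least; case: pselect => [exP|nP]; last first.
  by split=> // -[Pn _]; case: nP; exists n; apply/asboolP.
case: ex_minnP => m /asboolP Pm minm; split=> [[<-]|[Pn minn]].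
  by split=> // k Pk; apply/minm/asboolP.
by congr Some; apply/eqP; rewrite eqn_leq minn // minm //; apply/asboolP.
Qed.

Lemma least_NoneP (P : nat -> Prop) : least P = None <-> (forall n, ~ P n).
Proof.
rewrite /least; case: pselect => [exP|nP]; split=> //.
  by move=> nP; have [n /asboolP /nP] := exP.
by move=> _ n Pn; case: nP; exists n; apply/asboolP.
Qed.

Definition trivial_brace (A : skewBraceType) : Prop := forall a : A, a = 1.

Definition mpl (A : skewBraceType) : option nat :=
  least (fun n => trivial_brace (iter n Ret A)).

Definition yb12 (X : Type) (r : X * X -> X * X) (t : X * X * X) : X * X * X :=
  (r (t.1.1, t.1.2), t.2).
Definition yb23 (X : Type) (r : X * X -> X * X) (t : X * X * X) : X * X * X :=
  (t.1.1, (r (t.1.2, t.2)).1, (r (t.1.2, t.2)).2).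

Record solution := Solution {
  sol_carrier :> Type;
  sol_inhabited : inhabited sol_carrier;
  sol_map : sol_carrier * sol_carrier -> sol_carrier * sol_carrier;
  sol_map_bij : bijective sol_map;
  sol_braid : forall t, yb12 sol_map (yb23 sol_map (yb12 sol_map t)) =
                        yb23 sol_map (yb12 sol_map (yb23 sol_map t));
  sol_sigma_bij : forall x, bijective (fun y => (sol_map (x, y)).1);
  sol_tau_bij : forall y, bijective (fun x => (sol_map (x, y)).2) }.

Definition trivial_solution (S : solution) : Prop :=
  forall x y : S, sol_map (x, y) = (y, x).

Section SolutionTheory.
Variable S : solution.
Implicit Types x y z : S.

(** [sol_map (x, y) = (sigma x y, tau y x)] *)
Definition sigma x : Perm S := mk_perm (sol_sigma_bij x).
Definition tau y : Perm S := mk_perm (sol_tau_bij y).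

Local Notation "'σ' x" := (papp (sigma x)) (at level 9, x at level 9).
Local Notation "'τ' x" := (papp (tau x)) (at level 9, x at level 9).

Lemma sol_mapE x y : sol_map (x, y) = (σ x y, τ y x).
Proof. by rewrite [LHS]surjective_pairing. Qed.

Lemma braid_eqs x y z :
  [/\ σ (σ x y) (σ (τ y x) z) = σ x (σ y z),
      τ (σ (τ y x) z) (σ x y) = σ (τ (σ y z) x) (τ z y) &
      τ z (τ y x) = τ (τ z y) (τ (σ y z) x)].
Proof.
have E := sol_braid (x, y, z).
split; [exact: (congr1 (fun t => t.1.1) E)|exact: (congr1 (fun t => t.1.2) E)|].
exact: (congr1 snd E).
Qed.

Lemma sigmaM x y : sigma x * sigma y = sigma (σ x y) * sigma (τ y x).
Proof. by apply: perm_ext => z; have [] := braid_eqs x y z. Qed.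

Lemma tauM y z : tau z * tau y = tau (τ z y) * tau (σ y z).
Proof. by apply: perm_ext => x; have [] := braid_eqs x y z. Qed.

Lemma sol_map_inj x y x' y' :
  σ x y = σ x' y' -> τ y x = τ y' x' -> (x, y) = (x', y').
Proof.
by move=> e1 e2; apply: (bij_inj (sol_map_bij S)); rewrite !sol_mapE e1 e2.
Qed.

(** The diagonal map [y |-> (sigma y)^-1 y] is bijective *)

Lemma diag_surj z : exists y, σ y z = y.
Proof.
set y := papp (tau z)^-1 z; have ty : τ z y = z by rewrite pappKVg.
exists (σ y z); have := sigmaM y z; rewrite ty => /mulIg.
by move=> /(congr1 (fun f => papp f z)).
Qed.

Lemma diag_inj y y' z : σ y z = y -> σ y' z = y' -> y = y'.
Proof.
suff H v : σ v z = v -> v = σ (papp (tau z)^-1 z) z by move=> sy sy1; rewrite (H y sy) (H y' sy1).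
move=> {y y'} sv; have [g rK gK] := sol_map_bij S.
have gr x y : g (σ x y, τ y x) = (x, y) by rewrite -sol_mapE rK.
have g_braid t : yb12 g (yb23 g (yb12 g t)) = yb23 g (yb12 g (yb23 g t)).
  have g12K u : yb12 (@sol_map S) (yb12 g u) = u.
    by case: u => -[x y] w; rewrite /yb12 /= -surjective_pairing gK.
  have g23K u : yb23 (@sol_map S) (yb23 g u) = u.
    by case: u => -[x y] w; rewrite /yb23 /= -surjective_pairing gK.
  have r12K u : yb12 g (yb12 (@sol_map S) u) = u.
    by case: u => -[x y] w; rewrite /yb12 /= -surjective_pairing rK.
  have r23K u : yb23 g (yb23 (@sol_map S) u) = u.
    by case: u => -[x y] w; rewrite /yb23 /= -surjective_pairing rK.
  set u := RHS; rewrite -[t](_ : yb12 (@sol_map S) (yb23 (@sol_map S)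
    (yb12 (@sol_map S) u)) = _); first by rewrite r12K r23K r12K.
  by rewrite sol_braid /u g23K g12K g23K.
set a := τ z v; have gva : g (v, a) = (v, z) by rewrite -[in LHS]sv gr.
pose u := σ (papp (tau v)^-1 v) v.
have gu : (g (u, v)).2 = v by rewrite -[X in (_, X)](pappKVg (tau v)) gr.
have gvz : (g (v, z)).2 = z.
  by have := congr1 snd (g_braid (u, v, a)); rewrite /= gu gva /= gu.
set c := (g (v, z)).1; have := gK (v, z).
rewrite [g _]surjective_pairing gvz -/c sol_mapE => E.
have sc : σ c z = v := congr1 fst E; have tc : τ z c = z := congr1 snd E.
have -> : papp (tau z)^-1 z = c by rewrite -[X in papp _ X]tc pappVK.
exact: esym sc.
Qed.

(** The additive relations are [x + y = y + derived y x]. *)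
Definition derived y x : S := σ y (τ (papp (sigma x)^-1 y) x).

Lemma derived_sigma z y x : derived (σ z y) (σ z x) = σ z (derived y x).
Proof.
set e := papp (sigma x)^-1 y; have ye : y = σ x e by rewrite pappKVg.
rewrite /derived -/e.
have [e1 _ _] := braid_eqs z x e; have [_ e2 _] := braid_eqs z x e.
have -> : papp (sigma (σ z x))^-1 (σ z y) = σ (τ x z) e.
  by rewrite [in σ z y]ye -e1 pappVK.
rewrite e2 -ye.
by have [-> _ _] := braid_eqs z y (τ e x).
Qed.

End SolutionTheory.

Section StructureBrace.
Variable S : solution.
Implicit Types x y z : S.

Local Notation "'σ' x" := (papp (sigma x)) (at level 9, x at level 9).
Local Notation "'τ' x" := (papp (tau x)) (at level 9, x at level 9).

Definition mul_rel (u v : word S) : Prop := exists x y : S,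
  u = [:: (x, false); (y, false)] /\ v = [:: (σ x y, false); (τ y x, false)].

Definition add_rel (u v : word S) : Prop := exists x y : S,
  u = [:: (x, false); (y, false)] /\ v = [:: (y, false); (derived y x, false)].

Definition structure_group : Type := presented mul_rel.
Definition additive_structure_group : Type := presented add_rel.
HB.instance Definition _ := Group.on structure_group.
HB.instance Definition _ := Group.on additive_structure_group.

Local Notation G := structure_group.
Local Notation A := additive_structure_group.

Definition iota (x : S) : G := presented_gen mul_rel x.
Definition iota_add (x : S) : A := presented_gen add_rel x.

Lemma iotaM x y : iota x * iota y = iota (σ x y) * iota (τ y x).
Proof.
by rewrite -[LHS]word_class_cat -[RHS]word_class_cat;
  apply/word_classP/PresentedRel; exists x, y.
Qed.

Lemma iota_addE x y : iota_add x * iota_add y = iota_add y * iota_add (derived y x).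
Proof.
by rewrite -[LHS]word_class_cat -[RHS]word_class_cat;
  apply/word_classP/PresentedRel; exists x, y.
Qed.

Lemma mul_respects (H : groupType) (f : S -> H) :
  (forall x y, f x * f y = f (σ x y) * f (τ y x)) -> respects mul_rel f.
Proof. by move=> Hf _ _ [x [y [-> ->]]] /=; rewrite !mulg1. Qed.

Lemma add_respects (H : groupType) (f : S -> H) :
  (forall x y, f x * f y = f y * f (derived y x)) -> respects add_rel f.
Proof. by move=> Hf _ _ [x [y [-> ->]]] /=; rewrite !mulg1. Qed.

Lemma structure_group_ind (P : G -> Prop) :
  subgroup P -> (forall x, P (iota x)) -> forall g, P g.
Proof. exact: presented_ind. Qed.

Lemma additive_group_ind (P : A -> Prop) :
  subgroup P -> (forall x, P (iota_add x)) -> forall a, P a.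
Proof. exact: presented_ind. Qed.

(** The action of the structure group on [S] extending [sigma] *)

Definition sigmaG : G -> Perm S := presented_lift (R := mul_rel) (@sigma S).

Lemma sigma_respects : respects mul_rel (@sigma S).
Proof. by apply: mul_respects => x y; exact: sigmaM. Qed.

Lemma sigmaG_iota x : sigmaG (iota x) = sigma x.
Proof. exact: presented_lift_gen sigma_respects x. Qed.

Lemma sigmaGM g h : sigmaG (g * h) = sigmaG g * sigmaG h.
Proof. exact: presented_liftM sigma_respects g h. Qed.

Lemma sigmaG1 : sigmaG 1 = 1.
Proof. exact: presented_lift1 sigma_respects. Qed.

Lemma sigmaGV g : sigmaG g^-1 = (sigmaG g)^-1.
Proof. exact: presented_liftV sigma_respects g. Qed.

Lemma sigmaG_derived g x y :
  derived (papp (sigmaG g) y) (papp (sigmaG g) x) = papp (sigmaG g) (derived y x).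
Proof.
move: g x y; apply: structure_group_ind => [|z x y]; last first.
  by rewrite sigmaG_iota derived_sigma.
split=> [x y|g h Hg Hh x y|g Hg x y]; first by rewrite sigmaG1.
  by rewrite sigmaGM !pappM Hg Hh.
by apply: (@papp_inj _ (sigmaG g)); rewrite -Hg sigmaGV !pappKVg.
Qed.

Definition lamA (g : G) : A -> A :=
  presented_lift (R := add_rel) (fun x => iota_add (papp (sigmaG g) x)).

Lemma lamA_respects g : respects add_rel (fun x => iota_add (papp (sigmaG g) x)).
Proof. by apply: add_respects => x y; rewrite iota_addE sigmaG_derived. Qed.

Lemma lamA_iota g x : lamA g (iota_add x) = iota_add (papp (sigmaG g) x).
Proof. exact: presented_lift_gen (lamA_respects g) x. Qed.

Lemma lamAD g a b : lamA g (a * b) = lamA g a * lamA g b.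
Proof. exact: presented_liftM (lamA_respects g) a b. Qed.

Lemma lamA1r g : lamA g 1 = 1.
Proof. exact: presented_lift1 (lamA_respects g). Qed.

Lemma lamAN g a : lamA g a^-1 = (lamA g a)^-1.
Proof. exact: presented_liftV (lamA_respects g) a. Qed.

Lemma lamA1 a : lamA 1 a = a.
Proof.
move: a; apply: additive_group_ind => [|x]; last by rewrite lamA_iota sigmaG1.
by split=> [|a b Ha Hb|a Ha]; rewrite ?lamA1r ?lamAD ?lamAN ?Ha ?Hb.
Qed.

Lemma lamAM g h a : lamA (g * h) a = lamA g (lamA h a).
Proof.
move: a; apply: additive_group_ind => [|x]; last by rewrite !lamA_iota sigmaGM.
by split=> [|a b Ha Hb|a Ha]; rewrite ?lamA1r ?lamAD ?lamAN ?Ha ?Hb.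
Qed.

(** The bijective 1-cocycle [cocycle : G -> A] with [cocycle (iota x) = iota_add x]
    and [cocycle (g * h) = cocycle g * lamA g (cocycle h)] *)

Lemma affine_bij x : bijective (fun a : A => iota_add x * lamA (iota x) a).
Proof.
exists (fun a => lamA (iota x)^-1 ((iota_add x)^-1 * a)) => a.
  by rewrite mulKg -lamAM mulVg lamA1.
by rewrite -lamAM mulgV lamA1 mulVKg.
Qed.

Definition affine : G -> Perm A :=
  presented_lift (R := mul_rel) (fun x => mk_perm (affine_bij x)).

Lemma affine_respects : respects mul_rel (fun x => mk_perm (affine_bij x)).
Proof.
apply: mul_respects => x y; apply: perm_ext => a; rewrite !pappM !mk_permE.
rewrite !lamAD !lamA_iota !sigmaG_iota -!lamAM iotaM !mulgA iota_addE.
by rewrite /derived pappVK.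
Qed.

Definition cocycle (g : G) : A := papp (affine g) 1.

Lemma affineE g a : papp (affine g) a = cocycle g * lamA g a.
Proof.
have affM := presented_liftM affine_respects.
have aff1 := presented_lift1 affine_respects.
have affV := presented_liftV affine_respects.
move: g a; apply: structure_group_ind => [|x a]; last first.
  by rewrite /cocycle /affine (presented_lift_gen affine_respects) !mk_permE
    lamA1r mulg1.
split=> [a|g h Hg Hh a|g Hg a].
- by rewrite /cocycle /affine aff1 !papp1 mul1g lamA1.
- rewrite /cocycle /affine affM !pappM -/affine -/(affine _) -/(affine h).
  by rewrite !Hg !Hh lamA1r mulg1 lamAD mulgA lamAM.
rewrite /cocycle /affine affV -/(affine g).
have E b : papp (affine g)^-1 b = lamA g^-1 ((cocycle g)^-1 * b).
  apply: (@papp_inj _ (affine g)).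
  by rewrite pappKVg Hg -lamAM mulgV lamA1 mulVKg.
by rewrite !E !lamAD lamA1r mulg1.
Qed.

Lemma cocycleM g h : cocycle (g * h) = cocycle g * lamA g (cocycle h).
Proof.
by rewrite -affineE /cocycle /affine (presented_liftM affine_respects).
Qed.

Lemma cocycle1 : cocycle 1 = 1.
Proof. by rewrite /cocycle /affine (presented_lift1 affine_respects). Qed.

Lemma cocycle_iota x : cocycle (iota x) = iota_add x.
Proof.
by rewrite /cocycle /affine (presented_lift_gen affine_respects) mk_permE
  lamA1r mulg1.
Qed.

Lemma cocycleV g : cocycle g^-1 = (lamA g^-1 (cocycle g))^-1.
Proof.
by rewrite -[LHS]invgK; congr (_ ^-1); apply: mulg1_eq;
  rewrite -cocycleM mulVg cocycle1.
Qed.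

(** Its inverse, given by the right action [g |-> g + x] of the additive group *)

Definition translate x (g : G) : G := g * iota (papp (sigmaG g)^-1 x).

Lemma translate_bij x : bijective (translate x).
Proof.
have inj : injective (translate x).
  move=> g h; rewrite /translate.
  set y := papp (sigmaG g)^-1 x; set z := papp (sigmaG h)^-1 x => E.
  suff yz : y = z by move: E; rewrite yz => /mulIg.
  have Ey : σ y (papp (sigmaG (g * iota y))^-1 x) = y.
    by rewrite sigmaGM sigmaG_iota /y invgM pappM pappKVg.
  have Ez : σ z (papp (sigmaG (g * iota y))^-1 x) = z.
    by rewrite E sigmaGM sigmaG_iota /z invgM pappM pappKVg.
  exact: diag_inj Ey Ez.
have surj h : exists g, translate x g = h.
  have [z Hz] := diag_surj (papp (sigmaG h)^-1 x).
  exists (h * (iota z)^-1); rewrite /translate sigmaGM sigmaGV sigmaG_iota.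
  by rewrite invgM invgK pappM Hz mulgVK.
pose inv h := projT1 (cid (surj h)).
have invK : cancel inv (translate x) by move=> h; rewrite /inv; case: cid.
exists inv => // g; apply: inj; exact: invK.
Qed.

Lemma translate_respects : respects add_rel (fun x => (mk_perm (translate_bij x))^-1).
Proof.
apply: add_respects => x y; rewrite -!invgM; congr (_ ^-1).
apply: perm_ext => g; rewrite !pappM !mk_permE /translate.
rewrite !sigmaGM !sigmaG_iota -!mulgA; congr (_ * _).
set p := papp (sigmaG g)^-1 x; set w := papp (sigmaG g)^-1 y.
rewrite !invgM !pappM -/w iotaM pappKVg; congr (_ * iota _).
apply: (@papp_inj _ (sigma w)); rewrite pappKVg.
have -> : papp (sigmaG g)^-1 (derived y x) = derived w p.
  by rewrite /w /p -sigmaGV sigmaG_derived.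
by [].
Qed.

Definition translateA : A -> Perm G :=
  presented_lift (R := add_rel) (fun x => (mk_perm (translate_bij x))^-1).

Definition cocycle_inv (a : A) : G := papp (translateA a)^-1 1.

Let trM := presented_liftM translate_respects.
Let tr1 := presented_lift1 translate_respects.
Let trV := presented_liftV translate_respects.
Let tr_gen := presented_lift_gen translate_respects.

Lemma cocycle_translate a g : cocycle (papp (translateA a)^-1 g) = cocycle g * a.
Proof.
move: a g; apply: additive_group_ind => [|x g]; last first.
  rewrite /translateA tr_gen invgK mk_permE /translate cocycleM cocycle_iota.
  by rewrite lamA_iota pappKVg.
split=> [g|a b Ha Hb g|a Ha g]; first by rewrite /translateA tr1 invg1 mulg1.
  rewrite /translateA trM invgM pappM -/(translateA a) -/(translateA b).
  by rewrite Hb Ha mulgA.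
rewrite /translateA trV -/(translateA a) invgK.
apply: (@mulIg _ a); rewrite mulgVK -Ha.
by rewrite pappVK.
Qed.

Lemma cocycle_invK : cancel cocycle_inv cocycle.
Proof. by move=> a; rewrite cocycle_translate cocycle1 mul1g. Qed.

Lemma cocycleK : cancel cocycle cocycle_inv.
Proof.
suff H h g : papp (translateA (lamA g (cocycle h)))^-1 g = g * h.
  by move=> g; rewrite /cocycle_inv -{1}[cocycle g]lamA1 H mul1g.
move: h g; apply: structure_group_ind => [|x g]; last first.
  rewrite cocycle_iota lamA_iota /translateA tr_gen invgK mk_permE /translate.
  by rewrite pappVK.
split=> [g|h k Hh Hk g|h Hh g].
- by rewrite cocycle1 lamA1r /translateA tr1 invg1 mulg1.
- rewrite cocycleM lamAD /translateA trM invgM pappM.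
  by rewrite -/(translateA (lamA g _)) -/(translateA _) Hh -lamAM Hk mulgA.
rewrite cocycleV lamAN -lamAM /translateA trV invgK -/(translateA _).
have := Hh (g * h^-1); rewrite mulgVK => E.
by rewrite -[X in papp _ X]E pappKVg.
Qed.

(** The unique skew brace with multiplicative group [structure_group], additive group
    [additive_structure_group] (identified through [cocycle], which fixes the
    generators) and lambda maps extending [sigma] (lemma [blambda_iota]). *)

Definition structure_add (g h : G) : G := cocycle_inv (cocycle g * cocycle h).
Definition structure_opp (g : G) : G := cocycle_inv (cocycle g)^-1.

Lemma cocycleD g h : cocycle (structure_add g h) = cocycle g * cocycle h.
Proof. exact: cocycle_invK. Qed.
Lemma cocycleN g : cocycle (structure_opp g) = (cocycle g)^-1.
Proof. exact: cocycle_invK. Qed.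

Lemma structure_addA : associative structure_add.
Proof. by move=> g h k; apply: (can_inj cocycleK); rewrite !cocycleD mulgA. Qed.
Lemma structure_add1 : left_id 1 structure_add.
Proof. by move=> g; apply: (can_inj cocycleK); rewrite cocycleD cocycle1 mul1g. Qed.
Lemma structure_addN : left_inverse 1 structure_opp structure_add.
Proof.
by move=> g; apply: (can_inj cocycleK); rewrite cocycleD cocycleN mulVg cocycle1.
Qed.
Lemma structure_mulD (a b c : G) : a * structure_add b c =
  structure_add (structure_add (a * b) (structure_opp a)) (a * c).
Proof.
apply: (can_inj cocycleK); rewrite !(cocycleD, cocycleM, cocycleN) lamAD.
by rewrite !mulgA mulgVK.
Qed.

HB.instance Definition _ := Group_isSkewBrace.Build structure_group
  structure_addA structure_add1 structure_addN structure_mulD.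

Definition structure_brace : skewBraceType := structure_group.

Lemma blambda_cocycle (g h : structure_brace) :
  cocycle (blambda g h) = lamA g (cocycle h).
Proof. by rewrite /blambda cocycleD cocycleN cocycleM mulKg. Qed.

Lemma blambda_iota x y :
  blambda (A := structure_brace) (iota x) (iota y) = iota (σ x y).
Proof.
apply: (can_inj cocycleK).
by rewrite blambda_cocycle !cocycle_iota lamA_iota sigmaG_iota.
Qed.

Lemma blambda_sigmaG (g : structure_brace) x :
  blambda g (iota x : structure_brace) = iota (papp (sigmaG g) x).
Proof.
by apply: (can_inj cocycleK); rewrite blambda_cocycle !cocycle_iota lamA_iota.
Qed.

End StructureBrace.

Lemma inj_surj_bij (T U : Type) (f : T -> U) :
  injective f -> (forall u, exists t, f t = u) -> bijective f.
Proof.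
move=> f_inj f_surj; pose g u := projT1 (cid (f_surj u)).
have gK : cancel g f by move=> u; rewrite /g; case: cid.
by exists g => // t; apply: f_inj; rewrite gK.
Qed.

Section BraceTau.
Variable A : skewBraceType.
Implicit Types a b c : A.

Definition btau b a : A := (blambda a b)^-1 * (a * b).

Lemma blambda_mulr a b c :
  blambda a (b * c) = blambda a b * blambda (btau b a) c.
Proof.
rewrite [in LHS]bmulE blambdaD -blambdaM [in RHS]bmulE -blambdaM.
by rewrite /btau mulVKg.
Qed.

Lemma btauM a b c : btau (b * c) a = btau c (btau b a).
Proof. by rewrite /btau blambda_mulr invgM -/(btau b a) !mulgA. Qed.

Lemma btau1 a : btau 1 a = a.
Proof. by rewrite /btau blambda1 invg1 mul1g mulg1. Qed.

Lemma btau_inj b : injective (btau b).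
Proof. by move=> a c E; rewrite -[a]btau1 -[c]btau1 -(mulgV b) !btauM E. Qed.

End BraceTau.

Section PermutationBrace.
Variable S : solution.
Implicit Types x y z : S.

Local Notation "'σ' x" := (papp (sigma x)) (at level 9, x at level 9).
Local Notation "'τ' x" := (papp (tau x)) (at level 9, x at level 9).
Local Notation G := (structure_brace S).

Definition perm_pair x : Perm S * Perm S := (sigma x, (tau x)^-1).

Definition permutation_group : Type :=
  generated_subgroup (fun g : Perm S * Perm S => exists x, g = perm_pair x).
HB.instance Definition _ := Group.on permutation_group.

Lemma perm_gen_subproof x :
  `[< generated (fun g : Perm S * Perm S => exists x, g = perm_pair x) (perm_pair x) >].
Proof. by apply/asboolP => N _; apply; exists x. Qed.

Definition perm_gen x : permutation_group := GeneratedSub (perm_gen_subproof x).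

Lemma permutation_group_ext (g h : permutation_group) :
  generated_val g = generated_val h -> g = h.
Proof. exact: val_inj. Qed.

Lemma perm_respects : respects (@mul_rel S) perm_gen.
Proof.
apply: mul_respects => x y; apply: permutation_group_ext.
rewrite !(valM, gmulfM) /=.
rewrite /mul /= /mul_pair /=; congr (_, _); first exact: sigmaM.
by rewrite -!invgM tauM.
Qed.

Definition perm_pi : G -> permutation_group := presented_lift (R := @mul_rel S) perm_gen.

Lemma perm_pi_iota x : generated_val (perm_pi (iota x)) = (sigma x, (tau x)^-1).
Proof. by rewrite /perm_pi (presented_lift_gen perm_respects). Qed.

Lemma perm_piM : {morph perm_pi : g h / g * h}.
Proof. exact: presented_liftM perm_respects. Qed.

Lemma perm_pi1 : perm_pi 1 = 1.
Proof. exact: presented_lift1 perm_respects. Qed.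

Lemma perm_piV g : perm_pi g^-1 = (perm_pi g)^-1.
Proof. exact: presented_liftV perm_respects g. Qed.

Lemma perm_pi_surj (b : permutation_group) : exists g, perm_pi g = b.
Proof.
case: b => b bP; have /asboolP Hb := bP.
pose N (c : Perm S * Perm S) := exists g, generated_val (perm_pi g) = c.
suff [g Hg] : N b by exists g; apply: permutation_group_ext.
apply: Hb => [|_ [x ->]]; last by exists (iota x); exact: perm_pi_iota.
split=> [|_ _ [g <-] [h <-]|_ [g <-]].
- by exists 1; rewrite perm_pi1.
- by exists (g * h); rewrite perm_piM.
by exists g^-1; rewrite perm_piV.
Qed.

Lemma perm_pi_sigma (g : G) : (generated_val (perm_pi g)).1 = sigmaG g.
Proof.
move: g; apply: structure_group_ind => [|x]; last by rewrite perm_pi_iota sigmaG_iota.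
split=> [|g h Hg Hh|g Hg]; first by rewrite perm_pi1 sigmaG1.
  by rewrite perm_piM sigmaGM -Hg -Hh.
by rewrite perm_piV sigmaGV -Hg.
Qed.

Definition tauG (g : G) : Perm S := (generated_val (perm_pi g)).2.

Lemma tauGM g h : tauG (g * h) = tauG g * tauG h.
Proof. by rewrite /tauG perm_piM. Qed.
Lemma tauG1 : tauG 1 = 1.
Proof. by rewrite /tauG perm_pi1. Qed.
Lemma tauGV g : tauG g^-1 = (tauG g)^-1.
Proof. by rewrite /tauG perm_piV. Qed.
Lemma tauG_iota x : tauG (iota x) = (tau x)^-1.
Proof. by rewrite /tauG perm_pi_iota. Qed.

Lemma btau_tauG (g : G) x :
  btau g (iota x : G) = iota (papp (tauG g)^-1 x).
Proof.
move: g x; apply: structure_group_ind => [|y x]; last first.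
  by rewrite tauG_iota invgK /btau blambda_iota iotaM mulKg.
split=> [x|g h Hg Hh x|g Hg x].
- by rewrite btau1 tauG1 invg1.
- by rewrite btauM tauGM invgM pappM Hg Hh.
apply: (@btau_inj _ g); rewrite -btauM mulVg btau1 Hg.
by rewrite tauGV invgK pappVK.
Qed.

Lemma perm_ker_lambda (a h : G) : perm_pi h = 1 -> blambda a h = a * h * a^-1.
Proof.
move: a h; apply: structure_group_ind => [|x h Hh]; last first.
  have tH : tauG h = 1 by rewrite /tauG Hh.
  have := btau_tauG h x; rewrite tH invg1 papp1 /btau => E.
  by rewrite -[X in _ * X^-1]E invgM mulgA mulgV mul1g invgK.
split=> [h _|a b Ha Hb h Hh|a Ha h Hh].
- by rewrite blambda1l mul1g invg1 mulg1.
- rewrite blambdaM Hb // Ha; last first.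
    by rewrite !perm_piM perm_piV Hh mulg1 mulgV.
  by rewrite invgM !mulgA.
have -> : h = blambda a (a^-1 * h * a).
  rewrite Ha; first by rewrite !mulgA mulgV mul1g mulgK.
  by rewrite !perm_piM perm_piV Hh mulg1 mulVg.
by rewrite blambdaK Ha ?invgK ?mulgA ?mulVg ?mul1g ?mulgVK //
  !perm_piM perm_piV Hh mulg1 mulVg.
Qed.

Lemma perm_ker_lambda_id (a h : G) : perm_pi h = 1 -> blambda h a = a.
Proof.
move=> Hh; have sh : sigmaG h = 1 by rewrite -perm_pi_sigma Hh.
apply: (can_inj (@cocycleK S)); rewrite blambda_cocycle.
move: (cocycle a); apply: additive_group_ind => [|x]; last first.
  by rewrite lamA_iota sh.
by split=> [|b c Hb Hc|b Hb]; rewrite ?lamA1r ?lamAD ?lamAN ?Hb ?Hc.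
Qed.

Lemma perm_ker_ideal : ideal (fun g : G => perm_pi g = 1).
Proof.
have normK (a h : G) : perm_pi h = 1 -> perm_pi (a * h * a^-1) = 1.
  by move=> Hh; rewrite !perm_piM perm_piV Hh mulg1 mulgV.
have lamK (a h : G) : perm_pi h = 1 -> perm_pi (blambda a h) = 1.
  by move=> Hh; rewrite perm_ker_lambda // normK.
have addJ (a h : G) : perm_pi h = 1 -> perm_pi (a + h - a) = 1.
  move=> /(lamK a^-1); set k := blambda a^-1 h => Hk.
  have -> : a + h - a = a * k * a^-1; last exact: normK.
  by rewrite [RHS]bmulE blambdaM (perm_ker_lambda_id _ Hk) -bopp_mulV -baddE.
split=> //; split; [split=> [|g h Hg Hh|g Hg]| |split=> [|g h Hg Hh|g Hg]|] => //.
- exact: perm_pi1.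
- rewrite -[g * h]/(g + h : G) baddE perm_piM Hg mul1g; exact: lamK.
- rewrite -[g^-1]/(- g : G) bopp_mulV; apply: lamK.
  by rewrite perm_piV Hg invg1.
- exact: perm_pi1.
- by rewrite perm_piM Hg Hh mulg1.
- by rewrite perm_piV Hg invg1.
Qed.

Definition perm_section (b : permutation_group) : G := projT1 (cid (perm_pi_surj b)).

Lemma perm_sectionK : cancel perm_section perm_pi.
Proof. by move=> b; rewrite /perm_section; case: cid. Qed.

(** The only addition for which [perm_pi] is a morphism of skew braces, see
    [perm_piD]. *)
HB.instance Definition _ := Group_isSkewBrace.Build permutation_group
  (push_addA perm_piM perm_sectionK perm_ker_ideal)
  (push_add1 perm_piM perm_sectionK perm_ker_ideal)
  (push_addN perm_piM perm_sectionK perm_ker_ideal)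
  (push_mulD perm_piM perm_sectionK perm_ker_ideal).

Definition permutation_brace : skewBraceType := permutation_group.

Lemma perm_piD (g h : G) :
  perm_pi (g + h) = (perm_pi g : permutation_brace) + perm_pi h.
Proof. exact: (push_addP perm_piM perm_sectionK perm_ker_ideal). Qed.

Lemma perm_piN (g : G) : perm_pi (- g) = - (perm_pi g : permutation_brace).
Proof. exact: (push_oppP perm_piM perm_sectionK perm_ker_ideal). Qed.

Lemma perm_pi_lambda (g h : G) :
  perm_pi (blambda g h) = blambda (perm_pi g : permutation_brace) (perm_pi h).
Proof. by rewrite /blambda perm_piD perm_piN perm_piM. Qed.

Definition ret_rel : rel {classic S} :=
  fun x y => `[< sigma x = sigma y /\ tau x = tau y >].

Lemma ret_refl : reflexive ret_rel.
Proof. by move=> x; apply/asboolP. Qed.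
Lemma ret_sym : symmetric ret_rel.
Proof. by move=> x y; apply/asboolP/asboolP => -[]. Qed.
Lemma ret_trans : transitive ret_rel.
Proof.
move=> y x z /asboolP[sx tx] /asboolP[sy ty]; apply/asboolP.
by split; [rewrite sx sy|rewrite tx ty].
Qed.

Canonical ret_equiv := EquivRel ret_rel ret_refl ret_sym ret_trans.

Definition ret_carrier : Type := {eq_quot ret_equiv}.
Definition ret_class (x : S) : ret_carrier := \pi_{eq_quot ret_equiv} x.
Definition ret_repr (p : ret_carrier) : S := repr (p : {eq_quot ret_equiv}).

Lemma ret_reprK : cancel ret_repr ret_class.
Proof. exact: reprK. Qed.

Lemma ret_classP x y :
  ret_class x = ret_class y <-> sigma x = sigma y /\ tau x = tau y.
Proof.
have -> : (ret_class x = ret_class y) = (ret_rel x y : Prop).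
  by apply/propext; split=> [/eqmodP|H]; [|apply/eqmodP].
by split=> /asboolP.
Qed.

Lemma ret_class_perm x y :
  ret_class x = ret_class y <-> perm_pi (iota x) = perm_pi (iota y).
Proof.
split=> [/ret_classP[s t]|/(congr1 (@generated_val _ _))].
  by apply: permutation_group_ext; rewrite !perm_pi_iota s t.
rewrite !perm_pi_iota => E; apply/ret_classP; split; first exact: (congr1 fst E).
exact/invg_inj/(congr1 snd E).
Qed.

Definition ret_map (p : ret_carrier * ret_carrier) : ret_carrier * ret_carrier :=
  (ret_class (sol_map (ret_repr p.1, ret_repr p.2)).1,
   ret_class (sol_map (ret_repr p.1, ret_repr p.2)).2).

Let B := permutation_brace.
Let f x : B := perm_pi (iota x).

Lemma perm_pi_iota_sigma x y : f (σ x y) = blambda (f x) (f y).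
Proof. by rewrite -perm_pi_lambda blambda_iota. Qed.

Lemma perm_pi_iota_tau x y : f (τ y x) = btau (f y) (f x).
Proof.
rewrite /btau -perm_pi_iota_sigma /f -!perm_piM iotaM -perm_piV -perm_piM.
by rewrite mulKg.
Qed.

Lemma ret_mapE x y :
  ret_map (ret_class x, ret_class y) = (ret_class (σ x y), ret_class (τ y x)).
Proof.
have /ret_class_perm Ex := ret_reprK (ret_class x).
have /ret_class_perm Ey := ret_reprK (ret_class y).
rewrite /ret_map /= sol_mapE /=; congr (_, _); apply/ret_class_perm.
  by rewrite -![perm_pi _]/(f _) !perm_pi_iota_sigma /f Ex Ey.
by rewrite -![perm_pi _]/(f _) !perm_pi_iota_tau /f Ex Ey.
Qed.

Lemma ret_map_bij : bijective ret_map.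
Proof.
apply: inj_surj_bij => [[p q] [p' q']|[p q]].
  rewrite -[p]ret_reprK -[q]ret_reprK -[p']ret_reprK -[q']ret_reprK.
  move: (ret_repr p) (ret_repr q) (ret_repr p') (ret_repr q') => x y x' y'.
  rewrite !ret_mapE => -[/ret_class_perm + /ret_class_perm].
  rewrite -![perm_pi _]/(f _) !perm_pi_iota_sigma !perm_pi_iota_tau /btau.
  move=> Es; rewrite Es => /mulgI Em.
  have Ex : f x = f x'.
    apply: (@mulIg (additive B) (blambda (f x) (f y))).
    by rewrite [in RHS]Es [LHS](esym (bmulE _ _)) [RHS](esym (bmulE _ _)).
  have Ey : f y = f y' by move: Em; rewrite Ex => /mulgI.
  by congr (_, _); apply/ret_class_perm.
rewrite -[p]ret_reprK -[q]ret_reprK.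
have [g _ gK] := sol_map_bij S; set x := ret_repr p; set y := ret_repr q.
exists (ret_class (g (x, y)).1, ret_class (g (x, y)).2).
rewrite ret_mapE; have := gK (x, y); rewrite [g _]surjective_pairing sol_mapE => E.
congr (ret_class _, ret_class _); [exact: (congr1 fst E)|exact: (congr1 snd E)].
Qed.

Lemma ret_sigma_bij p : bijective (fun q => (ret_map (p, q)).1).
Proof.
rewrite -[p]ret_reprK; move: (ret_repr p) => x.
apply: inj_surj_bij => [q q'|q].
  rewrite -[q]ret_reprK -[q']ret_reprK !ret_mapE /= => /ret_class_perm.
  rewrite -![perm_pi _]/(f _) !perm_pi_iota_sigma => E.
  by apply/ret_class_perm; rewrite -[LHS](blambdaK (f x)) E blambdaK.
exists (ret_class (papp (sigma x)^-1 (ret_repr q))).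
by rewrite ret_mapE -[RHS]ret_reprK; congr ret_class; exact: pappKVg.
Qed.

Lemma ret_tau_bij q : bijective (fun p => (ret_map (p, q)).2).
Proof.
rewrite -[q]ret_reprK; move: (ret_repr q) => y.
apply: inj_surj_bij => [p p'|p].
  rewrite -[p]ret_reprK -[p']ret_reprK !ret_mapE /= => /ret_class_perm.
  rewrite -![perm_pi _]/(f _) !perm_pi_iota_tau => /btau_inj E.
  exact/ret_class_perm.
exists (ret_class (papp (tau y)^-1 (ret_repr p))).
by rewrite ret_mapE -[RHS]ret_reprK; congr ret_class; exact: pappKVg.
Qed.

Lemma ret_braid t : yb12 ret_map (yb23 ret_map (yb12 ret_map t)) =
                    yb23 ret_map (yb12 ret_map (yb23 ret_map t)).
Proof.
case: t => -[p q] s; rewrite -[p]ret_reprK -[q]ret_reprK -[s]ret_reprK.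
move: (ret_repr p) (ret_repr q) (ret_repr s) => x y z.
pose cl (t : S * S * S) := (ret_class t.1.1, ret_class t.1.2, ret_class t.2).
have E12 t : yb12 ret_map (cl t) = cl (yb12 (@sol_map S) t).
  by rewrite /yb12 ret_mapE.
have E23 t : yb23 ret_map (cl t) = cl (yb23 (@sol_map S) t).
  by rewrite /yb23 ret_mapE.
by rewrite -[(_, _, _)]/(cl (x, y, z)) !(E12, E23) sol_braid.
Qed.

Lemma ret_inhabited : inhabited ret_carrier.
Proof. by have [x] := sol_inhabited S; constructor; exact: ret_class. Qed.

(** The solution induced by [sol_map] on the quotient of [S] by the relation
    [sigma x = sigma y /\ tau x = tau y], see [ret_mapE] *)
Definition Ret_solution : solution :=
  Solution ret_inhabited ret_map_bij ret_braid ret_sigma_bij ret_tau_bij.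

End PermutationBrace.

Definition mpl_solution (S : solution) : option nat :=
  least (fun n => trivial_solution (iter n Ret_solution S)).

(* Main.v *)
From mathcomp Require Import all_boot.
From mathcomp Require Import boolp.
Require Import Defs.

(** For every solution [S], the permutation brace of [Ret_solution S] is isomorphic
    to [Ret (permutation_brace S)]: both are quotients of the structure brace of [S],
    and the two kernels agree. Indeed an element [b] of the permutation brace acts
    trivially on the retraction iff [blambda b a = a] and [blambda a b = a * b * a^-1]
    for all generators [a]; as the generators also generate the additive group, this
    amounts to [b] lying in the socle. Iterating, the n-th retraction of the
    permutation brace is the permutation brace of the n-th retraction, and a
    permutation brace is zero iff its solution is trivial. *)

Set Implicit Arguments.
Unset Strict Implicit.
Unset Printing Implicit Defensive.

Local Open Scope group_scope.
Local Open Scope brace_scope.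

(** * Morphisms and isomorphisms of skew braces *)

Record brace_morphism (A B : skewBraceType) (f : A -> B) : Prop := BraceMorphism {
  brace_morphismM : {morph f : a b / a * b};
  brace_morphismD : {morph f : a b / a + b} }.

Definition brace_iso (A B : skewBraceType) : Prop :=
  exists f : A -> B, brace_morphism f /\ bijective f.

Section BraceMorphismTheory.
Variables (A B : skewBraceType) (f : A -> B).
Hypothesis mf : brace_morphism f.

Lemma brace_morphism1 : f 1 = 1.
Proof. by apply: (@mulgI _ (f 1)); rewrite -(brace_morphismM mf) !mulg1. Qed.

Lemma brace_morphismV a : f a^-1 = (f a)^-1.
Proof.
by apply/esym/mulg1_eq; rewrite -(brace_morphismM mf) mulgV brace_morphism1.
Qed.

Lemma brace_morphism_eq a b : f a = f b <-> f (a^-1 * b) = 1.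
Proof.
rewrite (brace_morphismM mf) brace_morphismV; split=> [->|]; first exact: mulVg.
by move=> /mulg1_eq; rewrite invgK.
Qed.

Lemma brace_iso_Soc a : bijective f -> Soc (f a) <-> Soc a.
Proof.
case=> g fK gK; split=> Sa b.
  have [E1 E2] := Sa (f b).
  by split; apply: (can_inj fK); rewrite ?(brace_morphismM mf) !(brace_morphismD mf).
rewrite -[b]gK -(brace_morphismM mf) -!(brace_morphismD mf).
by have [-> ->] := Sa (g b).
Qed.

End BraceMorphismTheory.

Lemma brace_morphism_comp (A B C : skewBraceType) (g : B -> C) (f : A -> B) :
  brace_morphism g -> brace_morphism f -> brace_morphism (g \o f).
Proof.
move=> mg mf; split=> a b /=.
  by rewrite (brace_morphismM mf) (brace_morphismM mg).
by rewrite (brace_morphismD mf) (brace_morphismD mg).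
Qed.

Lemma quotient_pi_morphism (A : skewBraceType) (I : A -> Prop) (idI : ideal I) :
  brace_morphism (quotient_pi idI).
Proof. by split; [exact: quotient_piM|exact: quotient_piD]. Qed.

(** A merely set-theoretic section [s] of [p] suffices: [s (p a)] and [a] differ by an element of
    the common kernel, so [q \o s] does not depend on the choice of [s]. *)
Lemma same_kernel_iso (A B C : skewBraceType) (p : A -> B) (q : A -> C) :
  brace_morphism p -> brace_morphism q ->
  (forall b, exists a, p a = b) -> (forall c, exists a, q a = c) ->
  (forall a, p a = 1 <-> q a = 1) -> brace_iso B C.
Proof.
move=> mp mq p_surj q_surj ker.
pose s b := projT1 (cid (p_surj b)).
have sK : cancel s p by move=> b; rewrite /s; case: cid.
have fpE a : q (s (p a)) = q a.
  by apply/(brace_morphism_eq mq)/ker/(brace_morphism_eq mp); rewrite sK.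
exists (q \o s); split.
  split=> b b'; rewrite -[b]sK -[b']sK /=.
    by rewrite -(brace_morphismM mp) !fpE (brace_morphismM mq).
  by rewrite -(brace_morphismD mp) !fpE (brace_morphismD mq).
apply: inj_surj_bij => [b b' /=|c].
  move=> /(brace_morphism_eq mq)/ker/(brace_morphism_eq mp).
  by rewrite !sK.
by have [a <-] := q_surj c; exists (p a); exact: fpE.
Qed.

(** * The morphism from the structure brace of [S] onto [B'] *)

Section RetractionOfPermutationBrace.
Variable S : solution.
Implicit Types x y z : S.

Local Notation G := (structure_brace S).
Local Notation B := (permutation_brace S).
Local Notation B' := (permutation_brace (Ret_solution S)).
Local Notation cl := (@ret_class S).

Lemma ret_class_sigma x y :
  papp (sigma (cl x : Ret_solution S)) (cl y) = cl (papp (sigma x) y).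
Proof. by rewrite mk_permE [sol_map _]ret_mapE. Qed.

Lemma ret_class_tau x y :
  papp (tau (cl y : Ret_solution S)) (cl x) = cl (papp (tau y) x).
Proof. by rewrite mk_permE [sol_map _]ret_mapE. Qed.

Definition ret_gen x : B' := perm_pi (iota (cl x : Ret_solution S)).

Lemma ret_respects : respects (@mul_rel S) ret_gen.
Proof.
apply: mul_respects => x y.
by rewrite /ret_gen -!perm_piM iotaM ret_class_sigma ret_class_tau.
Qed.

Definition ret_pi : G -> B' := presented_lift (R := @mul_rel S) ret_gen.

Lemma ret_pi_iota x : ret_pi (iota x) = ret_gen x.
Proof. exact: presented_lift_gen ret_respects x. Qed.
Lemma ret_piM : {morph ret_pi : g h / g * h}.
Proof. exact: presented_liftM ret_respects. Qed.
Lemma ret_pi1 : ret_pi 1 = 1.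
Proof. exact: presented_lift1 ret_respects. Qed.
Lemma ret_piV g : ret_pi g^-1 = (ret_pi g)^-1.
Proof. exact: presented_liftV ret_respects g. Qed.

Lemma ret_pi_surj (b : B') : exists g, ret_pi g = b.
Proof.
have [h <-] := perm_pi_surj b; move: h; apply: structure_group_ind => [|p].
  split=> [|h1 h2 [g1 E1] [g2 E2]|h [g E]]; first by exists 1; rewrite perm_pi1 ret_pi1.
    by exists (g1 * g2); rewrite perm_piM ret_piM E1 E2.
  by exists g^-1; rewrite perm_piV ret_piV E.
by exists (iota (ret_repr p)); rewrite ret_pi_iota /ret_gen ret_reprK.
Qed.

(** As functions of [g], both sides come from actions of [G], so the generators [g] suffice. *)
Lemma ret_pi_lambda_iota (g : G) x :
  ret_pi (blambda g (iota x : G)) = blambda (ret_pi g) (ret_gen x).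
Proof.
rewrite blambda_sigmaG ret_pi_iota.
move: g x; apply: structure_group_ind => [|y x]; last first.
  by rewrite sigmaG_iota ret_pi_iota /ret_gen -ret_class_sigma perm_pi_iota_sigma.
split=> [x|g h Hg Hh x|g Hg x].
- by rewrite sigmaG1 ret_pi1 blambda1l.
- by rewrite sigmaGM ret_piM pappM Hg Hh blambdaM.
rewrite ret_piV -[LHS](blambdaK (ret_pi g)) -Hg.
by rewrite sigmaGV pappKVg.
Qed.

(** The induction is multiplicative in [h] with [g] generalized, because
    [blambda g (h * k) = blambda g h * blambda (btau h g) k]. *)
Lemma ret_pi_lambda (h g : G) :
  ret_pi (blambda g h) = blambda (ret_pi g) (ret_pi h).
Proof.
move: h g; apply: structure_group_ind => [|x g]; last first.
  by rewrite ret_pi_iota ret_pi_lambda_iota.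
have btauE (h : G) (Hh : forall g, ret_pi (blambda g h) = blambda (ret_pi g) (ret_pi h))
    g : ret_pi (btau h g) = btau (ret_pi h) (ret_pi g).
  by rewrite /btau !ret_piM ret_piV Hh.
split=> [g|h k Hh Hk g|h Hh g]; first by rewrite blambda1 ret_pi1 blambda1.
  by rewrite blambda_mulr !ret_piM blambda_mulr Hh Hk btauE.
(* With [g] written as [btau h g'], the term [blambda g h^-1] is the second factor in the expansion
   of [blambda g' (h * h^-1) = 1]. *)
have <- : btau h (btau h^-1 g) = g by rewrite -btauM mulVg btau1.
set g' := btau _ g.
apply: (@mulgI _ (ret_pi (blambda g' h))).
rewrite -ret_piM -blambda_mulr mulgV blambda1 ret_pi1.
by rewrite Hh (btauE _ Hh) -blambda_mulr ret_piV mulgV blambda1.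
Qed.

(** Addition is recovered from the product and lambda through [a + b = a * blambda a^-1 b]. *)
Lemma ret_pi_morphism : brace_morphism ret_pi.
Proof.
split=> [|g h]; first exact: ret_piM.
by rewrite baddE ret_piM ret_pi_lambda ret_piV -baddE.
Qed.

Lemma perm_pi_morphism : brace_morphism (@perm_pi S : G -> B).
Proof. by split; [exact: perm_piM|exact: perm_piD]. Qed.

(** * The kernel of [ret_pi] and the socle *)

Lemma ret_pi_sigma (g : G) x :
  papp (generated_val (ret_pi g)).1 (cl x) = cl (papp (sigmaG g) x).
Proof.
move: g x; apply: structure_group_ind => [|y x]; last first.
  by rewrite ret_pi_iota perm_pi_iota sigmaG_iota ret_class_sigma.
split=> [x|g h Hg Hh x|g Hg x]; first by rewrite ret_pi1 sigmaG1.
  by rewrite ret_piM sigmaGM !pappM -Hg -Hh.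
rewrite ret_piV; apply: (@papp_inj _ (generated_val (ret_pi g)).1).
by rewrite [LHS]pappKVg Hg sigmaGV pappKVg.
Qed.

Lemma ret_pi_tau (g : G) x :
  papp (generated_val (ret_pi g)).2 (cl x) = cl (papp (tauG g) x).
Proof.
move: g x; apply: structure_group_ind => [|y x]; last first.
  rewrite ret_pi_iota perm_pi_iota tauG_iota.
  apply: (@papp_inj _ (tau (cl y : Ret_solution S))).
  by rewrite pappKVg ret_class_tau pappKVg.
split=> [x|g h Hg Hh x|g Hg x]; first by rewrite ret_pi1 tauG1.
  by rewrite ret_piM tauGM !pappM -Hg -Hh.
rewrite ret_piV; apply: (@papp_inj _ (generated_val (ret_pi g)).2).
by rewrite [LHS]pappKVg Hg tauGV pappKVg.
Qed.

(** An element of [B'] is a pair of permutations of the retraction, and every point there is a class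
    [cl x]. The inverse of [tauG g] appears because it is the action given by [btau g]. *)
Lemma ret_pi_eq1 (g : G) : ret_pi g = 1 <->
  forall x, cl (papp (sigmaG g) x) = cl x /\ cl (papp (tauG g)^-1 x) = cl x.
Proof.
split=> [E x|E].
  have Es := ret_pi_sigma g x; have Et := ret_pi_tau g (papp (tauG g)^-1 x).
  by split; [rewrite -Es E|rewrite pappKVg in Et; rewrite -Et E].
apply: permutation_group_ext; rewrite [LHS]surjective_pairing.
congr (_, _); apply: perm_ext => p; rewrite -[p]ret_reprK.
  by rewrite ret_pi_sigma; have [-> _] := E (ret_repr p).
rewrite ret_pi_tau -(E (papp (tauG g) (ret_repr p))).2.
by rewrite pappVK.
Qed.

(** Two classes agree iff their generators agree in [B]; this expresses the kernel inside [B]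
    alone. *)
Lemma ret_pi_eq1_lambda (g : G) : ret_pi g = 1 <->
  forall x, let a : B := perm_pi (iota x) in
    blambda (perm_pi g : B) a = a /\ btau (perm_pi g : B) a = a.
Proof.
rewrite ret_pi_eq1.
have Es x : blambda (perm_pi g : B) (perm_pi (iota x)) =
    perm_pi (iota (papp (sigmaG g) x)).
  by rewrite -perm_pi_lambda blambda_sigmaG.
have Et x : btau (perm_pi g : B) (perm_pi (iota x)) =
    perm_pi (iota (papp (tauG g)^-1 x)).
  by rewrite /btau -perm_pi_lambda -!perm_piM -perm_piV -perm_piM -btau_tauG.
by split=> E x; have [] := E x; rewrite /= Es Et => /ret_class_perm ? /ret_class_perm.
Qed.

Lemma permutation_brace_add_ind (P : B -> Prop) :
  subgroup (G := additive B) P -> (forall x, P (perm_pi (iota x))) -> forall b, P b.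
Proof.
move=> sP Px b; have [g <-] := perm_pi_surj b.
(* The additive presentation of [G] is available only through [cocycle], so the induction runs over
   its target. *)
rewrite -[g]cocycleK; move: (cocycle g) => a {g b}.
move: a; apply: additive_group_ind => [|x]; last by rewrite -cocycle_iota cocycleK.
have D a c : cocycle_inv (a * c) = (cocycle_inv a + cocycle_inv c : G).
  by apply: (can_inj (@cocycleK S)); rewrite cocycleD !cocycle_invK.
have N a : cocycle_inv a^-1 = (- cocycle_inv a : G).
  by apply: (can_inj (@cocycleK S)); rewrite cocycleN !cocycle_invK.
split=> [|a c Pa Pc|a Pa].
- by rewrite -(@cocycle1 S) cocycleK perm_pi1; exact: (subgroup1 sP).
- by rewrite D perm_piD; exact: (subgroupM sP Pa Pc).
by rewrite N perm_piN; exact: (subgroupV sP Pa).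
Qed.

Lemma ret_pi_ker_Soc (g : G) : ret_pi g = 1 <-> Soc (perm_pi g : B).
Proof.
split=> [Eg|Sg]; last first.
  have /SocP[lg _] := Sg; apply/ret_pi_eq1_lambda => x; split; first exact: lg.
  (* For [g] in the socle, [blambda a g = a * g * a^-1], so [btau g a = (a * g * a^-1)^-1 * (a * g)
     = a]. *)
  by rewrite /btau -(Soc_conj _ Sg) invgM invgK mulgVK.
(* [blambda g] is an additive endomorphism fixing the additive generators. *)
have lam b : blambda (perm_pi g : B) b = b.
  have /ret_pi_eq1_lambda E := Eg.
  move: b; apply: permutation_brace_add_ind => [|x]; last by have [] := E x.
  split=> [|b c Eb Ec|b Eb]; first exact: blambda1.
    by rewrite [LHS]blambdaD Eb Ec.
  by rewrite [LHS]blambdaN Eb.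
apply/SocP; split=> //.
apply: permutation_brace_add_ind => [|x].
  split=> [|b c Eb Ec|b Eb]; first by rewrite baddr1 badd1.
    by rewrite [LHS]baddA Eb -baddA Ec baddA.
  rewrite /inv /=; apply: (@baddI _ b).
  by rewrite baddA -Eb baddgK baddVKg.
set a : B := perm_pi (iota x).
(* The conjugate [k] of [g] is also in the kernel, hence [blambda a k] is [g]. *)
pose k : G := (iota x)^-1 * g * iota x.
have Ek : ret_pi k = 1 by rewrite !ret_piM ret_piV Eg mulg1 mulVg.
have /ret_pi_eq1_lambda/(_ x)[_] := Ek; rewrite -/a /btau => tk.
have ak : a * perm_pi k = perm_pi g * a.
  by rewrite /k !perm_piM perm_piV -/a !mulgA mulgV mul1g.
have lk : blambda a (perm_pi k : B) = perm_pi g.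
  by apply: (@mulIg _ a); rewrite -ak -{2}tk mulVKg.
(* Writing [g] and [k] for their images in [B]: [a + g = a + blambda a k = a * k = g * a = g +
   blambda g a = g + a]. *)
by rewrite -[in RHS]lk -bmulE ak bmulE lam.
Qed.

(** Stated for any [A] isomorphic to [B], so that it serves as the induction step: iterated
    retractions are identified only up to isomorphism. *)
Lemma Ret_permutation_brace (A : skewBraceType) :
  brace_iso B A -> brace_iso B' (Ret A).
Proof.
case=> f [mf bf]; have [f' _ f'K] := bf.
pose p : G -> Ret A := quotient_pi (@Soc_ideal A) \o (f \o @perm_pi S).
have mp : brace_morphism p.
  apply: brace_morphism_comp (quotient_pi_morphism _) _.
  exact: brace_morphism_comp mf perm_pi_morphism.
apply: same_kernel_iso ret_pi_morphism mp ret_pi_surj _ _ => [c|g].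
  have [a ->] := quotient_pi_surj c; have [g Eg] := perm_pi_surj (f' a).
  by exists g; rewrite /p /= Eg f'K.
rewrite ret_pi_ker_Soc -(brace_iso_Soc mf _ bf); split.
  by move=> ?; apply/quotient_pi_eq1.
by move/quotient_pi_eq1.
Qed.

Lemma permutation_brace_trivial : trivial_brace B <-> trivial_solution S.
Proof.
split=> [tB x y|tS b].
  have := congr1 (@generated_val _ _) (tB (perm_pi (iota x))).
  have := congr1 (@generated_val _ _) (tB (perm_pi (iota y))).
  rewrite !perm_pi_iota => /(congr1 snd)/= ty /(congr1 fst)/= sx.
  by rewrite sol_mapE sx -[tau y]invgK ty invg1.
have [g <-] := perm_pi_surj b; move: g; apply: structure_group_ind => [|x].
  split=> [|g h Eg Eh|g Eg]; first exact: perm_pi1.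
    by rewrite perm_piM Eg Eh mulg1.
  by rewrite perm_piV Eg invg1.
apply: permutation_group_ext; rewrite perm_pi_iota.
congr (_, _); last rewrite -[RHS]invg1; last congr _^-1.
  by apply: perm_ext => y; rewrite mk_permE tS.
by apply: perm_ext => y; rewrite mk_permE tS.
Qed.

End RetractionOfPermutationBrace.

(** * Iterated retractions and multipermutation levels *)

Lemma iter_Ret_permutation_brace (S : solution) n :
  brace_iso (permutation_brace (iter n Ret_solution S))
            (iter n Ret (permutation_brace S)).
Proof.
elim: n => [|n IHn] /=; last exact: Ret_permutation_brace.
by exists id; split=> //; exists id.
Qed.

Lemma brace_iso_trivial (A B : skewBraceType) :
  brace_iso A B -> trivial_brace A <-> trivial_brace B.
Proof.
case=> f [mf [g fK gK]]; split=> tr b.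
  by rewrite -[b]gK [g b]tr brace_morphism1.
by apply: (can_inj fK); rewrite [RHS]tr [LHS]tr.
Qed.

Theorem theorem3p10 (S : solution) :
  mpl_solution S = mpl (permutation_brace S).
Proof.
(* Agreement of the two predicates at every [n] also settles the infinite case. *)
congr least; apply/funext => n; apply/propext.
rewrite -permutation_brace_trivial.
exact/brace_iso_trivial/iter_Ret_permutation_brace.
Qed.
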